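(* Let $A$ be a unital Banach algebra such that $A=\operatorname{span}\{ab-ba : a,b\in A\}$ (linear span, no closure). Then $A$ is biamenable.
   Context: A Banach $A$-bimodule is a Banach space $X$ which is an $A$-bimodule with continuous module operations. Its dual $X^*$ is a Banach $A$-bimodule via $(a\cdot f)(x)=f(xa)$ and $(f\cdot a)(x)=f(ax)$. A derivation $d:A\to X$ is a bounded linear map with $d(ab)=d(a)b+a\,d(b)$. A biderivation $D:A\times A\to X$ is a bounded bilinear map such that for all $a,b\in A$ the maps $D(a,\cdot)$ and $D(\cdot,b)$ are derivations $A\to X$. Put $Z(A,X)=\{x\in X: ax=xa\ \ \forall a\in A\}$. For $x\in Z(A,X)$ the map $\Delta_x(a,b)=x[a,b]=x(ab-ba)$ is called an inner biderivation. $A$ is called biamenable if for every Banach $A$-bimodule $X$ every biderivation $D:A\times A\to X^*$ is inner, i.e. $D=\Delta_\phi$ for some $\phi\in Z(A,X^* )$. *)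

(* Defs.v *)
From HB Require Import structures.
From mathcomp Require Import all_boot all_order all_algebra.
From mathcomp Require Import sesquilinear.
From mathcomp Require Import ring.
From mathcomp Require Import all_classical all_reals all_analysis.
From mathcomp.real_closed Require Import complex.

Set Implicit Arguments.
Unset Strict Implicit.
Unset Printing Implicit Defensive.

Import Order.TTheory GRing.Theory Num.Theory.
Import numFieldNormedType.Exports.

Local Open Scope classical_set_scope.
Local Open Scope ring_scope.

(* The scalar fields: MathComp-Analysis norms take values in the scalar field
   itself, so an operator norm requires suprema of bounded sets of nonnegative
   scalars. The intended instances, declared below, are the real numbers and
   the complex numbers. *)
HB.mixin Record NumField_isScalarField K of Num.NumField K := {
  nneg_supremums : forall S : set K, S `<=` [set x | 0 <= x] ->
    S !=set0 -> has_ubound S -> supremums S !=set0;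
  scalar_complete : forall F : set_system K, ProperFilter F ->
    (forall e, 0 < e -> exists x, F [set y | `|x - y| < e]) ->
    exists l, forall e, 0 < e -> F [set y | `|l - y| < e]
}.

#[short(type="scalarFieldType")]
HB.structure Definition ScalarField :=
  {K of Num.NumField K & NumField_isScalarField K}.

Section real_scalars.
Variable R : realType.

Lemma real_nneg_supremums (S : set R) : S `<=` [set x | 0 <= x] ->
  S !=set0 -> has_ubound S -> supremums S !=set0.
Proof.
move=> _ S0 ubS; exists (sup S); split.
  exact: ub_le_sup.
by move=> y; exact: ge_sup.
Qed.

Lemma real_scalar_complete (F : set_system R) : ProperFilter F ->
  (forall e, 0 < e -> exists x, F [set y | `|x - y| < e]) ->
  exists l, forall e, 0 < e -> F [set y | `|l - y| < e].
Proof.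
move=> FF Fc.
have /R_complete/cvg_ex[l /cvgrPdist_lt Fl] : cauchy F by apply/cauchyP.
by exists l.
Qed.

#[non_forgetful_inheritance]
HB.instance Definition _ :=
  NumField_isScalarField.Build R real_nneg_supremums real_scalar_complete.

End real_scalars.

Section complex_scalars.
Variable R : realType.

Lemma complex_nneg_supremums (S : set R[i]) : S `<=` [set x | 0 <= x] ->
  S !=set0 -> has_ubound S -> supremums S !=set0.
Proof.
move=> Sp [s0 Ss0] [M ubM].
have nnegE (z : R[i]) : 0 <= z -> z = (complex.Re z)%:C%C.
  by case: z => a b; rewrite lecE /= => /andP[/eqP -> _].
pose T : set R := [set complex.Re z | z in S].
have ubT : has_ubound T.
  by exists (complex.Re M) => _ [z Sz <-]; move: (ubM _ Sz); rewrite lecE => /andP[].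
have T0 : T !=set0 by exists (complex.Re s0), s0.
exists (sup T)%:C%C; split.
  move=> z Sz; rewrite (nnegE _ (Sp _ Sz)) lecR.
  by apply: ub_le_sup => //; exists z.
move=> y uby.
have y0 : 0 <= y by apply: le_trans (uby _ Ss0); exact: Sp.
rewrite (nnegE _ y0) lecR; apply: ge_sup => // _ [z Sz <-].
by move: (uby _ Sz); rewrite lecE => /andP[].
Qed.

Lemma complex_scalar_complete (F : set_system R[i]) : ProperFilter F ->
  (forall e, 0 < e -> exists x, F [set y | `|x - y| < e]) ->
  exists l, forall e, 0 < e -> F [set y | `|l - y| < e].
Proof.
move=> FF Fc.
have leRe (z : R[i]) : `|complex.Re z|%:C%C <= `|z|.
  case: z => a b; rewrite normc_def lecR -sqrtr_sqr ler_wsqrtr//.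
  by rewrite lerDl sqr_ge0.
have leIm (z : R[i]) : `|complex.Im z|%:C%C <= `|z|.
  case: z => a b; rewrite normc_def lecR -sqrtr_sqr ler_wsqrtr//.
  by rewrite lerDr sqr_ge0.
have comp (p : R[i] -> R) : (forall z w, p (z - w) = p z - p w) ->
    (forall z, `|p z|%:C%C <= `|z|) -> cvg (p @ F).
  move=> pB lep; apply: R_complete; apply/cauchyP => e e0.
  have /Fc[z Fz] : 0 < e%:C%C :> R[i] by rewrite ltcR.
  exists (p z); rewrite /fmap/=; apply: filterS Fz => w.
  rewrite -ball_normE/= -pB => zw.
  by rewrite -ltcR; apply: le_lt_trans zw; exact: lep.
have /comp/(_ leRe)/cvg_ex[/= a Fa] :
  forall z w : R[i], complex.Re (z - w) = complex.Re z - complex.Re w.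
  by move=> [? ?] [? ?].
have /comp/(_ leIm)/cvg_ex[/= b Fb] :
  forall z w : R[i], complex.Im (z - w) = complex.Im z - complex.Im w.
  by move=> [? ?] [? ?].
exists (a +i* b)%C => e e0.
have eE : e = (complex.Re e)%:C%C.
  by case: e e0 => c d; rewrite ltcE /= => /andP[/eqP -> _].
have r0 : 0 < complex.Re e / 2.
  by rewrite divr_gt0//; move: e0; rewrite ltcE => /andP[].
move/cvgrPdist_lt : Fa => /(_ _ r0) Fa.
move/cvgrPdist_lt : Fb => /(_ _ r0) Fb.
near=> z => /=.
have -> : (a +i* b)%C - z =
    (a - complex.Re z)%:C%C + (0 +i* (b - complex.Im z))%C.
  by case: {+}z => c d; simpc.
rewrite (le_lt_trans (ler_normD _ _))//.
rewrite !normc_def /= !expr0n/= !addr0 !add0r !sqrtr_sqr -rmorphD/= eE ltcR.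
rewrite [ltRHS]splitr; apply: ltrD; near: z; [exact: Fa|exact: Fb].
Unshelve. all: by end_near. Qed.

HB.instance Definition _ :=
  NumField_isScalarField.Build R[i] complex_nneg_supremums complex_scalar_complete.

End complex_scalars.

Section dual.
Variables (K : scalarFieldType) (X : normedModType K).

Definition dual_pred : {pred X -> K^o} :=
  mem [set f : X -> K^o | linear f /\ continuous f].

Record dual := Dual {
  dual_fun :> X -> K^o;
  dualP : dual_fun \in dual_pred
}.

HB.instance Definition _ := [isSub for dual_fun].
HB.instance Definition _ := gen_eqMixin dual.
HB.instance Definition _ := gen_choiceMixin dual.

Lemma dual_linear (f : dual) : linear f.
Proof. by have := dualP f; rewrite inE => -[]. Qed.

Lemma dual_continuous (f : dual) : continuous (f : X -> K^o).
Proof. by have := dualP f; rewrite inE => -[]. Qed.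

HB.instance Definition _ (f : dual) :=
  GRing.isLinear.Build K X K^o *:%R f (dual_linear f).

Lemma dual_submod_closed : submod_closed dual_pred.
Proof.
split.
  rewrite inE; split=> [a x y|x]; first by rewrite /= scaler0 addr0.
  exact: cvg_cst.
move=> a f g; rewrite !inE => -[lf cf] [lg cg]; split.
  move=> b x y.
  by rewrite !fctE lf lg !scalerDr !scalerA (mulrC a) addrACA.
move=> x; apply: continuousD; last exact: cg.
by apply: continuousZr; exact: cf.
Qed.

HB.instance Definition _ := GRing.isSubmodClosed.Build _ _ dual_pred
  dual_submod_closed.
HB.instance Definition _ := [SubChoice_isSubLmodule of dual by <:].

Lemma dualDE (f g : dual) x : (f + g) x = f x + g x.
Proof. by []. Qed.

Lemma dualZE a (f : dual) x : (a *: f) x = a * f x.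
Proof. by []. Qed.

Lemma dual_ext (f g : dual) : f =1 g -> f = g.
Proof. by move=> fg; apply/val_inj/funext. Qed.

Definition dual_norm (f : dual) : K :=
  supremum 0 [set `|f x| | x in [set x : X | `|x| <= 1]].

Lemma dual_bounded (f : dual) :
  exists2 M, 0 <= M & forall x, `|f x| <= M * `|x|.
Proof.
have /linear_bounded_continuous/linear_boundedP/pinfty_ex_gt0[M M0 fM] :=
  @dual_continuous f.
by exists M => //; exact: ltW.
Qed.

Lemma dual_norm_sup (f : dual) :
  supremums [set `|f x| | x in [set x : X | `|x| <= 1]] (dual_norm f).
Proof.
set S := [set _ | _ in _].
have S0 : S !=set0 by exists `|f 0|, 0 => //=; rewrite normr0.
have [M M0 fM] := dual_bounded f.
have : supremums S !=set0.
  apply: nneg_supremums => //; first by move=> _ [x _ <-] /=.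
  exists M => _ [x /= x1 <-]; rewrite (le_trans (fM x))//.
  by rewrite ler_piMr.
move=> [s Ss]; rewrite /dual_norm /supremum.
rewrite -/S ifF; last exact/negbTE/set0P.
by apply: xgetPex; exists s.
Qed.

Lemma dual_norm_ge0 (f : dual) : 0 <= dual_norm f.
Proof.
have [/(_ `|f 0|) ub _] := dual_norm_sup f.
by rewrite (le_trans _ (ub _))//; exists 0 => //=; rewrite normr0.
Qed.

Lemma dual_normP (f : dual) x : `|f x| <= dual_norm f * `|x|.
Proof.
have [->|x0] := eqVneq x 0; first by rewrite linear0 !normr0 mulr0.
have x_gt0 : 0 < `|x| by rewrite normr_gt0.
have [/(_ `|f (`|x|^-1 *: x)|) ub _] := dual_norm_sup f.
rewrite -ler_pdivrMr// mulrC.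
have -> : `|x|^-1 * `|f x| = `|f (`|x|^-1 *: x)|.
  by rewrite linearZ /= normrM normfV normr_id.
apply: ub; exists (`|x|^-1 *: x) => //=.
by rewrite normrZ normfV normr_id mulVf// gt_eqF.
Qed.

Lemma dual_norm_le (f : dual) M :
  0 <= M -> (forall x, `|f x| <= M * `|x|) -> dual_norm f <= M.
Proof.
move=> M0 fM; have [_] := dual_norm_sup f; apply => _ [x /= x1 <-].
by rewrite (le_trans (fM x))// ler_piMr.
Qed.

Lemma dual_ler_normD (f g : dual) :
  dual_norm (f + g) <= dual_norm f + dual_norm g.
Proof.
apply: dual_norm_le => [|x]; first by rewrite addr_ge0 ?dual_norm_ge0.
by rewrite dualDE mulrDl (le_trans (ler_normD _ _))// lerD ?dual_normP.
Qed.

Lemma dual_normrZ (a : K) (f : dual) : dual_norm (a *: f) = `|a| * dual_norm f.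
Proof.
have le b g : dual_norm (b *: g) <= `|b| * dual_norm g.
  apply: dual_norm_le => [|x]; first by rewrite mulr_ge0 ?dual_norm_ge0.
  by rewrite dualZE normrM -mulrA ler_wpM2l// dual_normP.
apply/eqP; rewrite eq_le le/=.
have [->|a0] := eqVneq a 0; first by rewrite normr0 mul0r dual_norm_ge0.
have := le a^-1 (a *: f); rewrite scalerA mulVf// scale1r normfV.
by rewrite ler_pdivlMl ?normr_gt0.
Qed.

Lemma dual_normr0_eq0 (f : dual) : dual_norm f = 0 -> f = 0.
Proof.
move=> f0; apply: dual_ext => x; apply/eqP.
by rewrite -normr_le0 (le_trans (dual_normP f x))// f0 mul0r.
Qed.

HB.instance Definition _ := Lmodule_isNormed.Build K dual
  dual_ler_normD dual_normrZ dual_normr0_eq0.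

Lemma dual_apply_le (f : dual) x : `|f x| <= `|f| * `|x|.
Proof. exact: dual_normP. Qed.

Lemma dual_norm_leP (f : dual) (M : K) :
  0 <= M -> (forall x, `|f x| <= M * `|x|) -> `|f| <= M.
Proof. exact: dual_norm_le. Qed.

Section bounded_functional.
Variables (f : X -> K^o) (M : K).
Hypotheses (lf : linear f) (M0 : 0 <= M) (fM : forall x, `|f x| <= M * `|x|).

Lemma bounded_in_dual : f \in dual_pred.
Proof.
rewrite inE; split => //.
pose g : {linear X -> K^o} := HB.pack f (GRing.isLinear.Build _ _ _ _ f lf).
apply: (@bounded_linear_continuous _ _ _ g); apply/linear_boundedP.
near=> r => x; rewrite (le_trans (fM x))// ler_wpM2r//.
by near: r; apply: nbhs_pinfty_ge; exact: ger0_real.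
Unshelve. all: by end_near. Qed.

Definition dual_of_bound : dual := Dual bounded_in_dual.
End bounded_functional.

Lemma dual_complete (F : set_system dual) :
  ProperFilter F -> cauchy F -> cvg F.
Proof.
move=> FF /cauchyP Fc.
have Fx (x : X) : exists l : K, forall e : K, 0 < e ->
    \forall f \near F, `|l - (f : dual) x| < e.
  apply: (@scalar_complete K ((fun f : dual => f x : K) @ F)) => e e0.
  have n0 : 0 < `|x| + 1 by rewrite ltr_wpDl.
  have /Fc[f Ff] : 0 < e / (`|x| + 1) by rewrite divr_gt0.
  exists (f x); rewrite /fmap/=; apply: filterS Ff => g.
  rewrite -ball_normE/= ltr_pdivlMr// => fg.
  rewrite (_ : f x - g x = (f - g) x)//.
  rewrite (le_lt_trans (dual_apply_le _ _))//.
  by rewrite (le_lt_trans _ fg)// ler_wpM2l// lerDl.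
pose l x := projT1 (cid (Fx x)).
have lP (x : X) (e : K) : 0 < e ->
    \forall f \near F, `|l x - (f : dual) x| < e.
  exact: (projT2 (cid (Fx x))).
have eq0P (k : K) (c : K) : 0 <= c -> (forall e, 0 < e -> `|k| <= c * e) -> k = 0.
  move=> c0 kc; apply/eqP; rewrite -normr_le0; apply/ler_addgt0Pl => e e0.
  have c1 : 0 < c + 1 by rewrite ltr_wpDl.
  rewrite addr0 (le_trans (kc (e / (c + 1)) _)) ?divr_gt0//.
  by rewrite mulrCA ler_piMr ?ltW// ltr_pdivrMr// mul1r ltrDl.
have ll : linear (l : X -> K^o).
  move=> a x y; apply/eqP; rewrite -subr_eq0; apply/eqP.
  apply: (@eq0P _ (2 + `|a|)); first by rewrite addr_ge0.
  move=> e e0; near F => f.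
  have fxy : `|l (a *: x + y) - f (a *: x + y)| <= e.
    by apply: ltW; near: f; exact: lP.
  have fx : `|l x - f x| <= e by apply: ltW; near: f; exact: lP.
  have fy : `|l y - f y| <= e by apply: ltW; near: f; exact: lP.
  have -> : l (a *: x + y) - (a *: (l x : K^o) + l y) =
     (l (a *: x + y) - f (a *: x + y)) - a * (l x - f x) - (l y - f y).
    have idn (u v w p q : K) :
      u - (a * v + w) = (u - (a * p + q)) - a * (v - p) - (w - q) by ring.
    by rewrite (dual_linear f a x y); exact: idn.
  have -> : (2 + `|a|) * e = e + `|a| * e + e by ring.
  rewrite (le_trans (ler_normB _ _))// lerD//.
  by rewrite (le_trans (ler_normB _ _))// lerD// normrM ler_wpM2l.
have close (e : K) : 0 < e ->
    \forall f \near F, forall x, `|l x - (f : dual) x| <= e * `|x|.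
  move=> e0; have /Fc[g Fg] : 0 < e / 2 by rewrite divr_gt0.
  near=> f => x.
  apply/ler_addgt0Pr => d d0.
  near F => h.
  have lh : `|l x - h x| <= d by apply: ltW; near: h; exact: lP.
  have gh : ball g (e / 2) h by near: h.
  have gf : ball g (e / 2) f by near: f.
  move: gh gf; rewrite -ball_normE/= => gh gf.
  have hf : `|h - f| <= e.
    rewrite (_ : h - f = (g - f) - (g - h)); last first.
      by rewrite [RHS]addrC opprB addrA subrK.
    by rewrite (le_trans (ler_normB _ _))// [leRHS]splitr lerD// ltW.
  rewrite (_ : l x - f x = (h - f) x + (l x - h x)); last first.
    by rewrite [RHS]addrC dualDE addrA subrK.
  rewrite (le_trans (ler_normD _ _))// lerD//.
  by rewrite (le_trans (dual_apply_le _ _))// ler_wpM2r.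
have [g gl] : exists g : dual, forall x, `|l x - g x| <= 1 * `|x|.
  by near F => g; exists g; near: g; exact: close.
have lM x : `|l x| <= (1 + `|g|) * `|x|.
  rewrite -[l x](subrK (g x)) (le_trans (ler_normD _ _))// mulrDl lerD//.
  exact: dual_apply_le.
have M0 : 0 <= 1 + `|g| by rewrite addr_ge0.
apply/cvg_ex; exists (dual_of_bound ll M0 lM); apply/cvgrPdist_le => /= e e0.
have := close _ e0; apply: filterS => f fe.
by apply: dual_norm_leP; [exact: ltW|exact: fe].
Unshelve. all: by end_near. Qed.

HB.instance Definition _ := Uniform_isComplete.Build dual dual_complete.

End dual.

(* Not assumed unital, hence not built on [algType]. *)
HB.mixin Record CompleteNormedModule_isBanachAlgebra (K : numFieldType) A
    of CompleteNormedModule K A := {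
  bmul : A -> A -> A;
  bmulA : associative bmul;
  bmul_bilinear : bilinear_for *:%R *:%R bmul;
  bmul_norm : forall a b, `|bmul a b| <= `|a| * `|b|
}.

#[short(type="banachAlgType")]
HB.structure Definition BanachAlgebra (K : numFieldType) :=
  {A of CompleteNormedModule K A & CompleteNormedModule_isBanachAlgebra K A}.

Notation "a ** b" := (bmul a b) (at level 40, left associativity) : ring_scope.

(* The actions are not assumed to be unital, even when [A] is. *)
HB.mixin Record NormedModule_isBimodule (K : numFieldType)
    (A : banachAlgType K) X of NormedModule K X := {
  lact : A -> X -> X;
  ract : X -> A -> X;
  lact_bilinear : bilinear_for *:%R *:%R lact;
  ract_bilinear : bilinear_for *:%R *:%R ract;
  lactA : forall a b x, lact (a ** b) x = lact a (lact b x);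
  ractA : forall x a b, ract x (a ** b) = ract (ract x a) b;
  lractA : forall a x b, ract (lact a x) b = lact a (ract x b);
  lact_continuous : continuous (fun p : A * X => lact p.1 p.2);
  ract_continuous : continuous (fun p : X * A => ract p.1 p.2)
}.

#[short(type="normedBimodType")]
HB.structure Definition NormedBimodule (K : numFieldType)
    (A : banachAlgType K) :=
  {X of NormedModule K X & NormedModule_isBimodule K A X}.

#[short(type="banachBimodType")]
HB.structure Definition BanachBimodule (K : numFieldType)
    (A : banachAlgType K) :=
  {X of NormedBimodule K A X & CompleteNormedModule K X}.

Section bilinear_bounded.
Variables (K : numFieldType) (U V W : normedModType K) (f : U -> V -> W).
Hypothesis lf : bilinear_for *:%R *:%R f.

Lemma bilinear_continuous_bounded : continuous (fun p => f p.1 p.2) ->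
  exists2 k, 0 < k & forall u v, `|f u v| <= k * `|u| * `|v|.
Proof.
pose g : {bilinear U -> V -> W} :=
  HB.pack f (bilinear_isBilinear.Build _ _ _ _ _ _ f lf).
exact: (@bilinear_schwarz _ _ _ _ g).
Qed.

Lemma bilinear_bounded_continuous (k : K) : 0 <= k ->
  (forall u v, `|f u v| <= k * `|u| * `|v|) -> continuous (fun p => f p.1 p.2).
Proof.
move=> k0 fk [u0 v0] /=; apply/cvgrPdist_lt => /= e e0.
pose g : {bilinear U -> V -> W} :=
  HB.pack f (bilinear_isBilinear.Build _ _ _ _ _ _ f lf).
pose c := k * (`|u0| + `|v0| + 1) + 1.
have c0 : 0 < c by rewrite ltr_wpDl// mulr_ge0// !addr_ge0.
have t0 : 0 < e / c by rewrite divr_gt0.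
have Bt := nbhsx_ballx ((u0, v0) : U * V) _ t0.
have B1 := nbhsx_ballx ((u0, v0) : U * V) _ (@ltr01 K).
near=> p.
have : ball ((u0, v0) : U * V) (e / c) p by near: p.
have : ball ((u0, v0) : U * V) 1 p by near: p.
rewrite -!ball_normE/= !prod_normE/= !num_gt_max/=.
move=> /andP[_ pv1] /andP[pu pv].
have -> : f u0 v0 - f p.1 p.2 = f u0 (v0 - p.2) + f (u0 - p.1) p.2.
  rewrite -[f]/(g : U -> V -> W) linearBr linearBl.
  by rewrite addrA subrK.
have p2 : `|p.2| <= `|v0| + 1.
  rewrite -[p.2](subKr v0) (le_trans (ler_normB _ _))// lerD// ltW//.
rewrite (le_lt_trans (ler_normD _ _))//.
apply: (@le_lt_trans _ _ ((c - 1) * (e / c))).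
  have -> : (c - 1) * (e / c) =
      k * `|u0| * (e / c) + k * (e / c) * (`|v0| + 1).
    by rewrite /c addrK -addrA mulrDr mulrDl (mulrAC k (e / _)).
  apply: lerD; rewrite (le_trans (fk _ _))//.
    by rewrite ler_wpM2l ?mulr_ge0// ltW.
  by rewrite ler_pM// ?mulr_ge0// ler_wpM2l// ltW.
by rewrite mulrBl mul1r mulrCA divff ?gt_eqF// mulr1 ltrBlDr ltrDl divr_gt0.
Unshelve. all: by end_near. Qed.

End bilinear_bounded.

Section dual_bimodule.
Variables (K : scalarFieldType) (A : banachAlgType K) (X : normedBimodType A).

Let lact_bounded : exists2 k, 0 < k &
  forall (a : A) (x : X), `|lact a x| <= k * `|a| * `|x|.
Proof.
exact: (bilinear_continuous_bounded lact_bilinear lact_continuous).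
Qed.

Let ract_bounded : exists2 k, 0 < k &
  forall (x : X) (a : A), `|ract x a| <= k * `|x| * `|a|.
Proof.
exact: (bilinear_continuous_bounded ract_bilinear ract_continuous).
Qed.

Lemma dual_lact_subproof (a : A) (f : dual X) :
  (fun x => f (ract x a) : K^o) \in @dual_pred K X.
Proof.
have [k k0 rk] := ract_bounded.
apply: (@bounded_in_dual _ _ _ (`|f| * (k * `|a|))).
- by move=> c x y; rewrite (ract_bilinear.1 a c x y) (dual_linear f c).
- by rewrite !mulr_ge0// ltW.
- move=> x; rewrite (le_trans (dual_apply_le _ _))// -mulrA ler_wpM2l//.
  by rewrite mulrAC rk.
Qed.

Lemma dual_ract_subproof (f : dual X) (a : A) :
  (fun x => f (lact a x) : K^o) \in @dual_pred K X.
Proof.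
have [k k0 lk] := lact_bounded.
apply: (@bounded_in_dual _ _ _ (`|f| * (k * `|a|))).
- by move=> c x y; rewrite (lact_bilinear.2 a c x y) (dual_linear f c).
- by rewrite !mulr_ge0// ltW.
- by move=> x; rewrite (le_trans (dual_apply_le _ _))// -mulrA ler_wpM2l.
Qed.

(* (a . f)(x) = f(x a)  and  (f . a)(x) = f(a x) *)
Definition dual_lact (a : A) (f : dual X) : dual X :=
  Dual (dual_lact_subproof a f).
Definition dual_ract (f : dual X) (a : A) : dual X :=
  Dual (dual_ract_subproof f a).

Lemma dual_lact_bilinear : bilinear_for *:%R *:%R dual_lact.
Proof.
split=> [f|a] c u v; apply: dual_ext => x //=.
by rewrite (ract_bilinear.2 x c u v) (dual_linear f c).
Qed.

Lemma dual_ract_bilinear : bilinear_for *:%R *:%R dual_ract.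
Proof.
split=> [a|f] c u v; apply: dual_ext => x //=.
by rewrite (lact_bilinear.1 x c u v) (dual_linear f c).
Qed.

Lemma dual_lactA a b f :
  dual_lact (a ** b) f = dual_lact a (dual_lact b f).
Proof. by apply: dual_ext => x /=; rewrite ractA. Qed.

Lemma dual_ractA f a b :
  dual_ract f (a ** b) = dual_ract (dual_ract f a) b.
Proof. by apply: dual_ext => x /=; rewrite lactA. Qed.

Lemma dual_lractA a f b :
  dual_ract (dual_lact a f) b = dual_lact a (dual_ract f b).
Proof. by apply: dual_ext => x /=; rewrite lractA. Qed.

Lemma dual_lact_continuous :
  continuous (fun p : A * dual X => dual_lact p.1 p.2).
Proof.
have [k k0 rk] := ract_bounded.
apply: (bilinear_bounded_continuous dual_lact_bilinear (ltW k0)) => a f.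
apply: dual_norm_leP => [|x]; first by rewrite !mulr_ge0// ltW.
rewrite /= (le_trans (dual_apply_le _ _))// [k * _ * _]mulrC -mulrA.
by rewrite ler_wpM2l// mulrAC rk.
Qed.

Lemma dual_ract_continuous :
  continuous (fun p : dual X * A => dual_ract p.1 p.2).
Proof.
have [k k0 lk] := lact_bounded.
apply: (bilinear_bounded_continuous dual_ract_bilinear (ltW k0)) => f a.
apply: dual_norm_leP => [|x]; first by rewrite !mulr_ge0// ltW.
rewrite /= (le_trans (dual_apply_le _ _))// [k * _]mulrC -!mulrA.
by rewrite ler_wpM2l// mulrA lk.
Qed.

HB.instance Definition _ := NormedModule_isBimodule.Build K A (dual X)
  dual_lact_bilinear dual_ract_bilinear dual_lactA dual_ractA dual_lractA
  dual_lact_continuous dual_ract_continuous.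

End dual_bimodule.

Section biderivations.
Variables (K : numFieldType) (A : banachAlgType K).

Definition commutator (a b : A) : A := a ** b - b ** a.

Definition is_unital : Prop :=
  exists e : A, forall a, e ** a = a /\ a ** e = a.

Definition linear_span (V : lmodType K) (S : set V) : set V :=
  [set v | exists (n : nat) (c : 'I_n -> K) (s : 'I_n -> V),
    (forall i, S (s i)) /\ v = \sum_(i < n) c i *: s i].

Variable X : banachBimodType A.

Definition is_derivation (d : A -> X) : Prop :=
  [/\ linear d,
      exists M : K, forall a, `|d a| <= M * `|a|
    & forall a b, d (a ** b) = ract (d a) b + lact a (d b)].

Definition is_biderivation (D : A -> A -> X) : Prop :=
  [/\ bilinear_for *:%R *:%R D,
      exists M : K, forall a b, `|D a b| <= M * `|a| * `|b|,
      forall a, is_derivation (D a)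
    & forall b, is_derivation (D ^~ b)].

Definition bimod_center : set X := [set x | forall a, lact a x = ract x a].

Definition inner_biderivation (x : X) (a b : A) : X := ract x (commutator a b).

End biderivations.

Definition biamenable (K : scalarFieldType) (A : banachAlgType K) : Prop :=
  forall (X : banachBimodType A) (D : A -> A -> dual X),
    is_biderivation D ->
    exists2 phi : dual X, bimod_center phi & D = inner_biderivation phi.

(* Main.v *)
(** Computing [D (ab, cd)] in two ways gives [D(a,c)[b,d] = [a,c]D(b,d)] and then,
  replacing [b] by [ub], Bresar's identity [D(a,c)u[b,d] = [a,c]uD(b,d)]. Write the
  unit as [e = \sum_i c_i [a_i,b_i]] and put [phi = \sum_i c_i D(a_i,b_i)]. Summing
  the identity over one pair yields [phi [b,d] = e D(b,d)], summing it over both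
  pairs yields [phi u = u phi]. The actions need not be unital, but [[e,d] = 0]
  gives [D(e,d)eu = 0] for every commutator [u], hence [D(e,d)e = 0] and
  [D(a,c) = D(ea,c) = e D(a,c)]. *)
Require Import Defs.
From HB Require Import structures.
From mathcomp Require Import all_boot all_order all_algebra.
From mathcomp Require Import sesquilinear.
From mathcomp Require Import all_classical all_reals all_analysis.

Import GRing.Theory.

Local Open Scope classical_set_scope.
Local Open Scope ring_scope.

(** Registered bilinearity makes the generic [linearBl], [linearDr], [linear_sumr] apply to the
    product and the actions. *)
HB.instance Definition _ (K : numFieldType) (A : banachAlgType K) :=
  bilinear_isBilinear.Build K A A A *:%R *:%R (@bmul K A) bmul_bilinear.

HB.instance Definition _ (K : numFieldType) (A : banachAlgType K)
    (X : normedBimodType A) :=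
  bilinear_isBilinear.Build K A X X *:%R *:%R (@lact K A X) lact_bilinear.

HB.instance Definition _ (K : numFieldType) (A : banachAlgType K)
    (X : normedBimodType A) :=
  bilinear_isBilinear.Build K X A X *:%R *:%R (@ract K A X) ract_bilinear.

Section bimodule_theory.
Variables (K : numFieldType) (A : banachAlgType K) (X : normedBimodType A).
Implicit Types (a b : A) (x : X).

Lemma lactBl a b x : lact (a - b) x = lact a x - lact b x.
Proof. exact: linearBl. Qed.

Lemma ractBr x a b : ract x (a - b) = ract x a - ract x b.
Proof. exact: linearBr. Qed.

Lemma lact_sumZl n (c : 'I_n -> K) (s : 'I_n -> A) x :
  lact (\sum_i c i *: s i) x = \sum_i c i *: lact (s i) x.
Proof.
rewrite linear_sumlz; apply: eq_bigr => i _; exact: linearZl_LR.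
Qed.

Lemma lact_sumZr n (c : 'I_n -> K) a (s : 'I_n -> X) :
  lact a (\sum_i c i *: s i) = \sum_i c i *: lact a (s i).
Proof.
rewrite linear_sumr; apply: eq_bigr => i _; exact: linearZr_LR.
Qed.

Lemma ract_sumZl n (c : 'I_n -> K) (s : 'I_n -> X) a :
  ract (\sum_i c i *: s i) a = \sum_i c i *: ract (s i) a.
Proof.
rewrite linear_sumlz; apply: eq_bigr => i _; exact: linearZl_LR.
Qed.

Lemma ract_sumZr n (c : 'I_n -> K) x (s : 'I_n -> A) :
  ract x (\sum_i c i *: s i) = \sum_i c i *: ract x (s i).
Proof.
rewrite linear_sumr; apply: eq_bigr => i _; exact: linearZr_LR.
Qed.

End bimodule_theory.

(** Leibniz rule for [commutator _ c]: on the right the two terms [a ** c ** b] cancel. *)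
Lemma commutatorMl (K : numFieldType) (A : banachAlgType K) (a b c : A) :
  commutator (a ** b) c = commutator a c ** b + a ** commutator b c.
Proof.
rewrite /commutator [(_ - _) ** b]linearBl [a ** (_ - _)]linearBr/= !bmulA.
by rewrite [RHS]addrC addrA subrK.
Qed.

Section biderivation_identities.
Variables (K : numFieldType) (A : banachAlgType K) (X : banachBimodType A).
Variable D : A -> A -> X.
Hypothesis biD : is_biderivation D.

Lemma biderivationMl a b c : D (a ** b) c = ract (D a c) b + lact a (D b c).
Proof. by case: biD => _ _ _ /(_ c)[]. Qed.

Lemma biderivationMr a b c : D a (b ** c) = ract (D a b) c + lact b (D a c).
Proof. by case: biD => _ _ /(_ a)[]. Qed.

Lemma biderivation_commutator a b c d :
  ract (D a c) (commutator b d) = lact (commutator a c) (D b d).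
Proof.
have := biderivationMl a b (c ** d).
rewrite biderivationMr !(biderivationMl, biderivationMr) lactBl ractBr.
rewrite !linearDl !linearDr/= !lractA -!ractA -!lactA.
(* Both expansions contain the mixed terms [lact a (ract (D b c) d)] and [lact c (ract (D a d) b)],
   moved to the end and cancelled. *)
rewrite [_ + lact (c ** a) _ in LHS]addrC [LHS]addrACA.
rewrite [_ + lact (a ** c) _ in RHS]addrC [RHS]addrACA.
rewrite [lact c _ + lact a _]addrC => /addIr H.
by apply/eqP; rewrite subr_eq addrAC eq_sym subr_eq H addrC.
Qed.

Lemma biderivation_bresar a b c d u :
  ract (ract (D a c) u) (commutator b d) =
  lact (commutator a c) (lact u (D b d)).
Proof.
have := biderivation_commutator a (u ** b) c d.
rewrite commutatorMl biderivationMl !linearDr/= -lractA !ractA.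
(* The summands with [b] acting on the right agree by the previous identity for [u], [d]. *)
by rewrite biderivation_commutator => /addrI.
Qed.

Section unit_span.
Variables (e : A) (n : nat) (k : 'I_n -> K) (s t : 'I_n -> A).
Hypothesis eE : e = \sum_i k i *: commutator (s i) (t i).
Let phi := \sum_i k i *: D (s i) (t i).
Hypothesis e_unit : forall a, e ** a = a /\ a ** e = a.

Let bmul1l a : e ** a = a. Proof. exact: (e_unit a).1. Qed.
Let bmul1r a : a ** e = a. Proof. exact: (e_unit a).2. Qed.

Let ract1 (x : X) : ract x e = \sum_i k i *: ract x (commutator (s i) (t i)).
Proof. by rewrite eE ract_sumZr. Qed.

Lemma commutator1l a : commutator e a = 0.
Proof. by rewrite /commutator bmul1l bmul1r subrr. Qed.

(** Bresar's identity summed over the expansion of [e]. Keeping [u] free serves twice: [u = e]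
    recovers [D] from [phi], and a second summation gives centrality. *)
Lemma sum_lact_biderivation b d u :
  lact e (lact u (D b d)) = ract (ract phi u) (commutator b d).
Proof.
rewrite eE lact_sumZl !ract_sumZl; apply: eq_bigr => i _.
by rewrite biderivation_bresar.
Qed.

Lemma lact1_biderivation a c : lact e (D a c) = D a c.
Proof.
(* With [e = e ** e], one copy becomes the [u] of Bresar's identity and the other is expanded into
   commutators. *)
have De0 d : ract (D e d) e = 0.
  rewrite -[e in ract _ e]bmul1l ractA ract1.
  apply: big1 => i _.
  by rewrite biderivation_bresar commutator1l linear0l scaler0.
(* As [e] kills [D e c] from the right, so does [a = e ** a]. *)
by rewrite -[a in RHS]bmul1l biderivationMl -[X in ract _ X]bmul1l ractA De0
  linear0l add0r.
Qed.

Lemma ract_phi a b : ract phi (commutator a b) = D a b.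
Proof.
rewrite -[commutator a b]bmul1l ractA -sum_lact_biderivation.
by rewrite !lact1_biderivation.
Qed.

Lemma phi_center : bimod_center phi.
Proof.
(* Both sides become the sum of [k i *: lact e (lact u (D (s i) (t i)))]. *)
move=> u; rewrite -[in RHS](bmul1r u) ractA ract1.
rewrite -[in LHS](bmul1l u) lactA !lact_sumZr; apply: eq_bigr => i _.
by rewrite sum_lact_biderivation.
Qed.

End unit_span.

Lemma biderivation_inner :
  is_unital A ->
  linear_span [set commutator a b | a in [set: A] & b in [set: A]] = [set: A] ->
  exists2 phi : X, bimod_center phi & D = inner_biderivation phi.
Proof.
move=> [e eP] spanA.
(* The span hypothesis, applied to the unit, supplies the data defining [phi]. *)
have [n [k [v [vP eE]]]] :
  linear_span [set commutator a b | a in [set: A] & b in [set: A]] e.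
  by rewrite spanA.
have /choice[s /choice[t st]] :
  forall i, exists a, exists b, commutator a b = v i.
  by move=> i; have [a _ [b _ ab]] := vP i; exists a, b.
have {}eE : e = \sum_i k i *: commutator (s i) (t i).
  by rewrite eE; apply: eq_bigr => i _; rewrite st.
exists (\sum_i k i *: D (s i) (t i)); first exact: phi_center eE eP.
by apply/funext => a; apply/funext => b; symmetry; exact: ract_phi eE eP a b.
Qed.

End biderivation_identities.

Theorem theorem2p5 (K : scalarFieldType) (A : banachAlgType K) :
  is_unital A ->
  linear_span [set commutator a b | a in [set: A] & b in [set: A]] = [set: A] ->
  biamenable A.
Proof. by move=> A1 spanA X D biD; exact: biderivation_inner. Qed.
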